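(* Let $N_P$ be the simply connected 2-step nilpotent Lie group associated to the path graph $P$ on four vertices, equipped with the left-invariant metric for which the basis $V_1,V_2,V_3,V_4,Z_1,Z_2,Z_3$ of its Lie algebra $\mathfrak n_P$ is orthonormal. Identify $TN_P\simeq N_P\times\mathfrak n_P$ and, for $p=\exp(W)\in N_P$ and $Y\in\mathfrak n_P$, define $$E(p,Y)=\tfrac12\langle Y,Y\rangle,\qquad h(p,Y)=\langle Y,\,j(Y_{\mathfrak z})^2Y_{\mathfrak v}\rangle,\qquad f_{Z_i}(p,Y)=\langle Y,Z_i\rangle\ (i=1,2,3),$$ $$f_{V_1^*}(p,Y)=\langle V_1+\langle W,V_2\rangle Z_1,\,Y\rangle,\qquad f_{V_4^*}(p,Y)=\langle V_4-\langle W,V_3\rangle Z_3,\,Y\rangle .$$ Then $E,h,f_{Z_1},f_{Z_2},f_{Z_3},f_{V_1^*},f_{V_4^*}$ is a set of first integrals of the geodesic flow on $TN_P$ which are in involution.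
   Context: $\mathfrak n_P$ is the real Lie algebra with basis $V_1,V_2,V_3,V_4,Z_1,Z_2,Z_3$ and nonzero brackets $[V_1,V_2]=Z_1$, $[V_2,V_3]=Z_2$, $[V_3,V_4]=Z_3$ (and those obtained by skew-symmetry). Put $\mathfrak z=\mathrm{span}\{Z_1,Z_2,Z_3\}$ (the center) and $\mathfrak v=\mathrm{span}\{V_1,\dots,V_4\}=\mathfrak z^\perp$; $Y_{\mathfrak v},Y_{\mathfrak z}$ are the orthogonal projections of $Y$. For $Z\in\mathfrak z$, $j(Z):\mathfrak v\to\mathfrak v$ is the skew-symmetric map with $\langle j(Z)U,V\rangle=\langle[U,V],Z\rangle$ for $U,V\in\mathfrak v$. The identification $TN_P\simeq N_P\times\mathfrak n_P$ sends $v_p\in T_pN_P$ to $(p,Y)$, $Y$ being the left-invariant vector field with $Y(p)=v_p$; $\exp:\mathfrak n_P\to N_P$ is a diffeomorphism. $TN_P$ carries the symplectic form obtained from the canonical one on $T^*N_P$ via the metric, with Poisson bracket $\{\,,\}$ on $C^\infty(TN_P)$. A smooth $f:TN_P\to\mathbb R$ is a first integral of the geodesic flow if $\{f,E\}=0$. Functions are in involution if they pairwise Poisson commute. *)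

(* Defs.v *)
From HB Require Import structures.
From mathcomp Require Import all_boot all_order all_algebra.
From mathcomp Require Import all_classical all_reals all_analysis.
From mathcomp Require Import ring lra.

Set Implicit Arguments.
Unset Strict Implicit.
Unset Printing Implicit Defensive.

Import Order.TTheory GRing.Theory Num.Theory.
Import numFieldNormedType.Exports.

Local Open Scope classical_set_scope.
Local Open Scope ring_scope.

Section calculus.
Context {R : realType} {M : normedModType R}.

Definition iter_derive (vs : seq M) (f : M -> R) : M -> R :=
  foldr (fun v g => fun x => 'D_v g x) f vs.

(* For finite-dimensional [M] this is C^oo: each iterated directional
   derivative is differentiable, hence continuous. *)
Definition smooth (f : M -> R) : Prop :=
  forall (vs : seq M) (x : M), differentiable (iter_derive vs f) x.

(* Exterior derivative of a 1-form on a vector space, evaluated on the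
   constant vector fields [u] and [v]. *)
Definition ext_deriv (theta : M -> M -> R) (x u v : M) : R :=
  'D_u (theta^~ v) x - 'D_v (theta^~ u) x.

End calculus.

(* The basis V_1, ..., V_4, Z_1, Z_2, Z_3 of n_P is the standard basis of R^7,
   in this order. *)
Notation nP R := 'rV[R]_7 (only parsing).

Section lie_algebra.
Context {R : realType}.
Implicit Types X Y U W : nP R.

(* Meaningful for 1 <= i <= 4. *)
Definition V (i : nat) : nP R := \row_(k < 7) (k.+1 == i)%:R.

(* Meaningful for 1 <= i <= 3. *)
Definition Z (i : nat) : nP R := \row_(k < 7) (k.+1 == i + 4)%N%:R.

Definition dot X Y : R := \sum_(k < 7) X 0 k * Y 0 k.

(* The bilinear skew-symmetric extension of [V_k, V_(k+1)] = Z_k, k = 1, 2, 3. *)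
Definition bracket X Y : nP R :=
  \sum_(1 <= k < 4)
    (dot X (V k) * dot Y (V k.+1) - dot X (V k.+1) * dot Y (V k)) *: Z k.

Definition proj_v Y : nP R := \sum_(1 <= k < 5) dot Y (V k) *: V k.

Definition proj_z Y : nP R := \sum_(1 <= k < 4) dot Y (Z k) *: Z k.

(* The map j(S) : v -> v, for S in z: the coordinates of j(S)U in the
   orthonormal basis V_1, ..., V_4 of v are <[U, V_k], S>.  Its characterization
   is [jP] below. *)
Definition j (S U : nP R) : nP R :=
  \sum_(1 <= k < 5) dot (bracket U (V k)) S *: V k.

End lie_algebra.

(* As exp : n_P -> N_P is a diffeomorphism, N_P is represented by n_P, with
   p = exp(W) represented by W.  By the Baker-Campbell-Hausdorff formula in a
   2-step nilpotent Lie algebra, the product is then [mulN]; the vector space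
   [nP R] also serves as the tangent space at each point. *)
Section group.
Context {R : realType}.
Implicit Types p q W : nP R.

Definition mulN p q : nP R := p + q + 2^-1 *: bracket p q.

Definition invN p : nP R := - p.

(* Differential at [q] of left translation by [p]. *)
Definition dL p q (u : nP R) : nP R := 'D_u (mulN p) q.

Definition left_inv_field (Y : nP R) p : nP R := dL p 0 Y.

Definition metric p (u v : nP R) : R := dot (dL (invN p) p u) (dL (invN p) p v).

End group.

(* An element of TN_P = N_P x n_P is a pair (p, Y). *)
Notation TN R := ('rV[R]_7 * 'rV[R]_7)%type (only parsing).

(* An element of T*N_P is a pair (p, xi) where xi is the row of coordinates of a
   covector at p, with respect to the exponential coordinates on N_P. *)
Notation coTN R := ('rV[R]_7 * 'rV[R]_7)%type (only parsing).

Section symplectic.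
Context {R : realType}.

Definition pairing (xi u : 'rV[R]_7) : R := \sum_(k < 7) xi 0 k * u 0 k.

Definition liouville (c w : coTN R) : R := pairing c.2 w.1.

Definition canonical_form (c w1 w2 : coTN R) : R := - ext_deriv liouville c w1 w2.

(* The isomorphism TN_P -> T*N_P given by the metric: (p, Y) is the tangent
   vector Y(p), sent to the covector <Y(p), - >_p. *)
Definition flat (x : TN R) : coTN R :=
  (x.1, \row_(k < 7) metric x.1 (left_inv_field x.2 x.1) (delta_mx 0 k)).

(* Pull-back of the canonical form of T*N_P by [flat]. *)
Definition omega (x u v : TN R) : R :=
  canonical_form (flat x) ('D_u flat x) ('D_v flat x).

Definition is_hamiltonian_vector (f : TN R -> R) (x X : TN R) : Prop :=
  forall v, omega x X v = 'D_v f x.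

(* For [f] differentiable at [x] such a vector exists and is unique: see
   [hamiltonian_vectorP] and [is_hamiltonian_vector_uniq]. *)
Definition hamiltonian_vector (f : TN R -> R) (x : TN R) : TN R :=
  xget 0 [set X | is_hamiltonian_vector f x X].

Definition poisson (f g : TN R -> R) (x : TN R) : R :=
  omega x (hamiltonian_vector f x) (hamiltonian_vector g x).

End symplectic.

Section functions.
Context {R : realType}.
Implicit Types x : TN R.

Definition E x : R := 2^-1 * dot x.2 x.2.

Definition h x : R := dot x.2 (j (proj_z x.2) (j (proj_z x.2) (proj_v x.2))).

Definition fZ (i : nat) x : R := dot x.2 (Z i).

Definition fV1 x : R := dot (V 1 + dot x.1 (V 2) *: Z 1) x.2.

Definition fV4 x : R := dot (V 4 - dot x.1 (V 3) *: Z 3) x.2.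

Definition first_integral (f : TN R -> R) : Prop :=
  smooth f /\ forall x, poisson f E x = 0.

Definition in_involution (F : set (TN R -> R)) : Prop :=
  forall f g, F f -> F g -> forall x, poisson f g x = 0.

End functions.

Lemma is_derive_quadratic {R : realType} {M W : normedModType R} (f : M -> W)
    (a v : M) (A B : W) :
  (forall t : R, f (t *: v + a) = f a + t *: A + t ^+ 2 *: B) ->
  is_derive a v f A.
Proof.
move=> fE.
suff dfA : h^-1 *: ((f \o shift a) (h *: v) - f a) @[h --> (0:R)^'] --> A.
  by apply: DeriveDef; [apply/cvg_ex; exists A|exact: cvg_lim].
have : (A + t *: B) @[t --> (0:R)^'] --> A + 0 *: B.
  apply: cvgD; first exact: cvg_cst.
  by apply: cvgZr_tmp; apply: cvg_within.
rewrite scale0r addr0; apply: cvg_trans; apply: near_eq_cvg.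
near=> t.
have t0 : t != 0 by near: t; exact: nbhs_dnbhs_neq.
rewrite /= fE -[f a + _ + _]addrA [_ - f a]addrC addKr expr2.
by rewrite scalerDr !scalerA mulrA mulVf // mul1r scale1r.
Unshelve. all: by end_near. Qed.

Section facts.
Context {R : realType}.
Implicit Types X Y U W S p q : nP R.

Let sum_13 (T : nmodType) (F : nat -> T) :
  \sum_(1 <= k < 4) F k = F 1%N + F 2%N + F 3%N.
Proof. by rewrite 3?big_nat_recr //= big_geq // add0r. Qed.

Let sum_14 (T : nmodType) (F : nat -> T) :
  \sum_(1 <= k < 5) F k = F 1%N + F 2%N + F 3%N + F 4%N.
Proof. by rewrite big_nat_recr //= sum_13. Qed.

Definition crd X (i : nat) : R := X 0 (inord i).

Lemma dotE X Y :
  dot X Y = crd X 0 * crd Y 0 + crd X 1 * crd Y 1 + crd X 2 * crd Y 2 +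
    crd X 3 * crd Y 3 + crd X 4 * crd Y 4 + crd X 5 * crd Y 5 + crd X 6 * crd Y 6.
Proof.
rewrite /dot !big_ord_recr big_ord0 /= add0r /crd.
by do ![congr (_ + _)]; congr (X _ _ * Y _ _); apply/val_inj; rewrite /= inordK.
Qed.

Lemma crdV i k : (k < 7)%N -> crd (V i) k = (k.+1 == i)%:R.
Proof. by move=> k7; rewrite /crd mxE inordK. Qed.

Lemma crdZ i k : (k < 7)%N -> crd (Z i) k = (k.+1 == i + 4)%N%:R.
Proof. by move=> k7; rewrite /crd mxE inordK. Qed.

Lemma crdD X Y i : crd (X + Y) i = crd X i + crd Y i.
Proof. by rewrite /crd mxE. Qed.

Lemma crdN X i : crd (- X) i = - crd X i. Proof. by rewrite /crd mxE. Qed.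

Lemma crdS a X i : crd (a *: X) i = a * crd X i.
Proof. by rewrite /crd mxE. Qed.

Lemma crd0 i : crd 0 i = 0. Proof. by rewrite /crd mxE. Qed.

Definition crdE := (crdD, crdN, crdS, crd0, crdV, crdZ).

Lemma eq_crd X Y : (forall i, (i < 7)%N -> crd X i = crd Y i) -> X = Y.
Proof.
move=> XY; apply/rowP => k; have := XY k (ltn_ord k).
by rewrite /crd inord_val.
Qed.

Lemma dotV Y i : (i < 7)%N -> dot Y (V i.+1) = crd Y i.
Proof.
by move: i; do 7?[case=> [_|]]; last by []; rewrite dotE !crdV //=; ring.
Qed.

Lemma dotZ Y i : (1 <= i <= 3)%N -> dot Y (Z i) = crd Y (i + 3).
Proof.
by case: i => [|[|[|[|i]]]] // _; rewrite dotE !crdZ //=; ring.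
Qed.

Lemma crd_bracket X Y i : (i < 7)%N -> crd (bracket X Y) i =
  nth 0 [:: 0; 0; 0; 0; crd X 0 * crd Y 1 - crd X 1 * crd Y 0;
    crd X 1 * crd Y 2 - crd X 2 * crd Y 1;
    crd X 2 * crd Y 3 - crd X 3 * crd Y 2] i.
Proof.
rewrite /bracket sum_13 !dotV // => i7; rewrite !crdE //.
by move: i i7; do 7?[case=> [_|]]; last by []; rewrite /=; ring.
Qed.

Lemma crd_proj_v Y i : (i < 7)%N ->
  crd (proj_v Y) i = if (i < 4)%N then crd Y i else 0.
Proof.
rewrite /proj_v sum_14 !dotV // => i7; rewrite !crdE //.
by move: i i7; do 7?[case=> [_|]]; last by []; rewrite /=; ring.
Qed.

Lemma crd_proj_z Y i : (i < 7)%N ->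
  crd (proj_z Y) i = if (i < 4)%N then 0 else crd Y i.
Proof.
rewrite /proj_z sum_13 !dotZ // => i7; rewrite !crdE //.
by move: i i7; do 7?[case=> [_|]]; last by []; rewrite /=; ring.
Qed.

Lemma crd_j S U i : (i < 7)%N -> crd (j S U) i =
  nth 0 [:: - crd U 1 * crd S 4; crd U 0 * crd S 4 - crd U 2 * crd S 5;
    crd U 1 * crd S 5 - crd U 3 * crd S 6; crd U 2 * crd S 6; 0; 0; 0] i.
Proof.
rewrite /j sum_14 => i7; rewrite !crdE // !dotE !crd_bracket // !crdV //.
by move: i i7; do 7?[case=> [_|]]; last by []; rewrite /=; ring.
Qed.

Ltac coords :=
  apply: eq_crd; do 7?[case=> [_|]]; last by [];
  rewrite ?(crd_bracket, crd_proj_v, crd_proj_z, crd_j, crdE) //=;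
  try (first [by ring | by field]).

Lemma bracket_V12 : bracket (V 1) (V 2) = Z 1 :> nP R. Proof. coords. Qed.
Lemma bracket_V23 : bracket (V 2) (V 3) = Z 2 :> nP R. Proof. coords. Qed.
Lemma bracket_V34 : bracket (V 3) (V 4) = Z 3 :> nP R. Proof. coords. Qed.
Lemma bracket_V13 : bracket (V 1) (V 3) = 0 :> nP R. Proof. coords. Qed.
Lemma bracket_V14 : bracket (V 1) (V 4) = 0 :> nP R. Proof. coords. Qed.
Lemma bracket_V24 : bracket (V 2) (V 4) = 0 :> nP R. Proof. coords. Qed.

Lemma bracket_Z i Y : (1 <= i <= 3)%N -> bracket (Z i) Y = 0.
Proof. by case: i => [|[|[|[|i]]]] // _; coords. Qed.

Lemma bracketC X Y : bracket X Y = - bracket Y X.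
Proof. coords. Qed.

Lemma bracket_central X Y U : bracket (bracket X Y) U = 0.
Proof. coords. Qed.

Lemma proj_vzE Y : proj_v Y + proj_z Y = Y.
Proof. coords. Qed.

Lemma jP S U Y : proj_z S = S -> proj_v U = U -> proj_v Y = Y ->
  proj_v (j S U) = j S U /\ dot (j S U) Y = dot (bracket U Y) S.
Proof.
move=> _ _ <-; split; first by coords.
by rewrite !dotE !(crd_bracket, crd_proj_v, crd_j) //=; ring.
Qed.

Lemma bracket_shift (a : R) p X Y : bracket (X + a *: bracket p X) Y = bracket X Y.
Proof. coords. Qed.

Lemma bracket_shiftr (a : R) p X Y : bracket Y (X + a *: bracket p X) = bracket Y X.
Proof. by rewrite bracketC bracket_shift -bracketC. Qed.

Lemma mulNA p q U : mulN p (mulN q U) = mulN (mulN p q) U.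
Proof. rewrite /mulN; coords. Qed.

Lemma mul0N p : mulN 0 p = p. Proof. rewrite /mulN; coords. Qed.

Lemma mulN0 p : mulN p 0 = p. Proof. rewrite /mulN; coords. Qed.

Lemma mulVN p : mulN (invN p) p = 0. Proof. rewrite /mulN /invN; coords. Qed.

(* t |-> tW is the one-parameter subgroup with initial velocity W. *)
Lemma one_parameter W (s t : R) : mulN (s *: W) (t *: W) = (s + t) *: W.
Proof. rewrite /mulN; coords. Qed.

Lemma dLE p q U : dL p q U = U + 2^-1 *: bracket p U.
Proof.
apply: derive_val; apply: (is_derive_quadratic (B := 0)) => t.
rewrite /mulN; coords.
Qed.

Lemma left_inv_field_bracket X Y p :
  'D_(left_inv_field X p) (left_inv_field Y) p
    - 'D_(left_inv_field Y p) (left_inv_field X) p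
  = left_inv_field (bracket X Y) p.
Proof.
have L A q : left_inv_field A q = A + 2^-1 *: bracket q A by exact: dLE.
have D A B : 'D_B (left_inv_field A) p = 2^-1 *: bracket B A.
  apply: derive_val; apply: (is_derive_quadratic (B := 0)) => t.
  rewrite !L; coords.
rewrite [X in X - _]D [X in _ - X]D !L !bracket_shift (bracketC p) bracket_central.
by rewrite oppr0 scaler0 addr0 (bracketC Y) scalerN opprK -scalerDl -mulr2n
  -[_ *+ 2]mulr_natr mulVf ?scale1r ?pnatr_eq0.
Qed.

Definition coad p Y : nP R := \row_(k < 7) dot Y (bracket p (delta_mx 0 k)).

Lemma crd_coad p Y i : (i < 7)%N -> crd (coad p Y) i =
  nth 0 [:: - crd p 1 * crd Y 4; crd p 0 * crd Y 4 - crd p 2 * crd Y 5;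
    crd p 1 * crd Y 5 - crd p 3 * crd Y 6; crd p 2 * crd Y 6; 0; 0; 0] i.
Proof.
have crd_delta k l : (k < 7)%N -> (l < 7)%N ->
    crd (delta_mx 0 (inord k)) l = (l == k)%:R :> R.
  by move=> k7 l7; rewrite /crd mxE eqxx /= -val_eqE /= !inordK.
move=> i7; rewrite {1}/crd mxE dotE !(crd_bracket, crdE) //= !crd_delta //.
by move: i i7; do 7?[case=> [_|]]; last by []; rewrite /=; ring.
Qed.

Ltac coords' :=
  apply: eq_crd; do 7?[case=> [_|]]; last by [];
  rewrite ?(crd_coad, crd_bracket, crdE) //=; try (first [by ring | by field]).

Lemma dotC X Y : dot X Y = dot Y X.
Proof. by apply: eq_bigr => k _; rewrite mulrC. Qed.

Lemma dotDl X Y U : dot (X + Y) U = dot X U + dot Y U.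
Proof. by rewrite /dot -big_split; apply: eq_bigr => k _; rewrite mxE mulrDl. Qed.

Lemma dotZl (a : R) X U : dot (a *: X) U = a * dot X U.
Proof. by rewrite /dot mulr_sumr; apply: eq_bigr => k _; rewrite mxE mulrA. Qed.

Lemma dotNl X U : dot (- X) U = - dot X U.
Proof. by rewrite -scaleN1r dotZl mulN1r. Qed.

Lemma dotDr X Y U : dot U (X + Y) = dot U X + dot U Y.
Proof. by rewrite ![dot U _]dotC dotDl. Qed.

Lemma dotZr (a : R) X U : dot U (a *: X) = a * dot U X.
Proof. by rewrite ![dot U _]dotC dotZl. Qed.

Lemma dotNr X U : dot U (- X) = - dot U X.
Proof. by rewrite ![dot U _]dotC dotNl. Qed.

Lemma dot_delta X k : dot X (delta_mx 0 k) = X 0 k.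
Proof.
rewrite /dot (bigD1 k) //= big1 ?addr0 ?mxE ?eqxx ?mulr1 // => i ik.
by rewrite mxE (negbTE ik) andbF mulr0.
Qed.

Lemma dot_inj X Y : (forall U, dot X U = dot Y U) -> X = Y.
Proof. by move=> XY; apply/rowP => k; rewrite -!dot_delta. Qed.

Lemma dot_coadl p X Y : dot (coad p Y) X = dot Y (bracket p X).
Proof.
by rewrite !dotE !crd_coad // !crd_bracket //=; ring.
Qed.

Lemma dot_coadr p X Y : dot X (coad p Y) = dot Y (bracket p X).
Proof. by rewrite dotC dot_coadl. Qed.

Definition dot_lin := (dotDl, dotDr, dotNl, dotNr, dotZl, dotZr,
  dot_coadl, dot_coadr).

Lemma dLVK p Y : dL (invN p) p (left_inv_field Y p) = Y.
Proof.
rewrite /left_inv_field dLE [dL p 0 Y]dLE /invN.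
have -> (X : nP R) : bracket (- p) X = - bracket p X by coords.
by rewrite bracket_shiftr scalerN addrK.
Qed.

Lemma metric_left_inv_field Y p U :
  metric p (left_inv_field Y p) U = dot Y (U - 2^-1 *: bracket p U).
Proof.
rewrite /metric dLVK dLE /invN; congr (dot _ (_ + _)); coords.
Qed.

Lemma flatE (x : TN R) : flat x = (x.1, x.2 - 2^-1 *: coad x.1 x.2).
Proof.
congr pair; apply/rowP => k; rewrite !mxE metric_left_inv_field.
by rewrite -dot_delta dotDr dotNr dotZr.
Qed.

Lemma derive_flat (x u : TN R) :
  'D_u flat x = (u.1, u.2 - 2^-1 *: (coad u.1 x.2 + coad x.1 u.2)).
Proof.
apply: derive_val.
apply: (is_derive_quadratic (B := (0, - 2^-1 *: coad u.1 u.2))) => t.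
rewrite !flatE; congr pair; rewrite /=; coords'.
Qed.

Lemma canonical_formE (a w1 w2 : coTN R) :
  canonical_form a w1 w2 = dot w1.1 w2.2 - dot w1.2 w2.1.
Proof.
have D (w w' : coTN R) : 'D_w (liouville^~ w') a = dot w.2 w'.1.
  apply: derive_val; apply: (is_derive_quadratic (B := 0)) => t.
  rewrite /liouville /pairing -!/(dot _ _) !dotE !crdE.
  by rewrite /GRing.scale /=; ring.
by rewrite /canonical_form /ext_deriv !D !dotE; ring.
Qed.

Lemma omegaE (x u v : TN R) :
  let A := u.1 - 2^-1 *: bracket x.1 u.1 in
  let B := v.1 - 2^-1 *: bracket x.1 v.1 in
  omega x u v = dot A v.2 - dot B u.2 + dot x.2 (bracket A B).
Proof.
move=> A B; rewrite /omega canonical_formE !derive_flat /A /B -!scaleNr.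
rewrite bracket_shift bracket_shiftr /=.
rewrite !dot_lin (bracketC v.1) !dot_lin.
by rewrite (dotC v.1) (dotC v.2) (dotC (bracket _ _) u.2); field.
Qed.

Lemma derive_dot (f : TN R -> R) (x : TN R) : differentiable f x ->
  exists a b : nP R, forall v, 'D_v f x = dot a v.1 + dot b v.2.
Proof.
move=> df; exists (\row_k 'D_(delta_mx 0 k, 0) f x).
exists (\row_k 'D_(0, delta_mx 0 k) f x) => v.
have inl : linear (fun a : nP R => (a, 0) : TN R).
  by move=> t a b; congr pair; rewrite /= scaler0 addr0.
have inr : linear (fun a : nP R => (0, a) : TN R).
  by move=> t a b; congr pair; rewrite /= scaler0 addr0.
pose Lin := GRing.isLinear.Build R _ _ _ _ inl.
pose Rin := GRing.isLinear.Build R _ _ _ _ inr.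
pose l : {linear nP R -> TN R} := HB.pack (fun a : nP R => (a, 0) : TN R) Lin.
pose r : {linear nP R -> TN R} := HB.pack (fun a : nP R => (0, a) : TN R) Rin.
have -> : v = l v.1 + r v.2 by case: v => a b; congr pair; rewrite /= ?addr0 ?add0r.
rewrite deriveE // linearD {1}(row_sum_delta v.1) {1}(row_sum_delta v.2) /dot.
rewrite !linear_sum.
congr (_ + _); apply: eq_bigr => k _; rewrite !mxE !linearZ deriveE //=.
- by rewrite addr0 mulrC.
- by rewrite add0r mulrC.
Qed.

Lemma hamiltonian_vectorP (f : TN R -> R) (x : TN R) : differentiable f x ->
  is_hamiltonian_vector f x (hamiltonian_vector f x).
Proof.
move=> /derive_dot[a [b dfE]]; apply: xgetPex.
exists (b + 2^-1 *: bracket x.1 b, coad b x.2 - a - 2^-1 *: coad x.1 a) => v.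
rewrite dfE omegaE /= bracket_shiftr addrK.
set B := v.1 - _; have BE c : bracket c B = bracket c v.1.
  by rewrite /B -scaleNr bracket_shiftr.
have BD : B = v.1 - 2^-1 *: bracket x.1 v.1 by [].
clearbody B; rewrite !dot_lin !BE BD !dot_lin.
by rewrite (dotC v.1) (dotC (bracket _ _) a); field.
Qed.

Lemma is_hamiltonian_vector_uniq (f : TN R -> R) (x X Y : TN R) :
  is_hamiltonian_vector f x X -> is_hamiltonian_vector f x Y -> X = Y.
Proof.
move=> fX fY.
have {fX fY} XY v : omega x X v = omega x Y v by rewrite fX fY.
have b0 p : bracket p 0 = 0 by coords.
have d0 (p : nP R) : dot 0 p = 0 by rewrite -(scale0r p) dotZl mul0r.
have shiftK p (A : nP R) : A - 2^-1 *: bracket p A +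
    2^-1 *: bracket p (A - 2^-1 *: bracket p A) = A.
  by rewrite -scaleNr bracket_shiftr scaleNr subrK.
have shiftVK p (A : nP R) : A + 2^-1 *: bracket p A -
    2^-1 *: bracket p (A + 2^-1 *: bracket p A) = A.
  by rewrite bracket_shiftr addrK.
have X1 : X.1 = Y.1.
  rewrite -[LHS](shiftK x.1) -[RHS](shiftK x.1).
  suff -> : X.1 - 2^-1 *: bracket x.1 X.1 = Y.1 - 2^-1 *: bracket x.1 Y.1 by [].
  apply: dot_inj => U; have := XY (0, U).
  by rewrite !omegaE /= !b0 scaler0 subrr !b0 !d0 !subr0 !(dotC x.2) !d0 !addr0.
suff : X.2 = Y.2 by case: X Y X1 {XY} => ? ? [? ?] /= -> ->.
apply: dot_inj => U; have := XY (U + 2^-1 *: bracket x.1 U, 0).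
rewrite !omegaE /= !shiftVK X1 => /addIr/addrI/oppr_inj.
by rewrite !(dotC U).
Qed.

End facts.

(* Main.v *)
Require Import Defs.
From HB Require Import structures.
From mathcomp Require Import all_boot all_order all_algebra.
From mathcomp Require Import all_classical all_reals all_analysis.
From mathcomp Require Import ring.

Import Order.TTheory GRing.Theory Num.Theory.
Import numFieldNormedType.Exports.

Local Open Scope classical_set_scope.
Local Open Scope ring_scope.

(** In the left trivialization, let f have gradient (a, b) at (p, Y), and let g
    have gradient (a', b').  Inverting the symplectic form gives
    {f, g} = <a, b' + [p, b'] / 2> - <a', b + [p, b] / 2> - <Y, [b, b']>.
    All seven functions are polynomial in the coordinates, hence smooth.  For
    g = f_{Z_i} we have a' = 0 and b' = Z_i is central, so the bracket reduces to
    <a, Z_i>, which vanishes since no function of the list has a gradient along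
    the center of the base.  By skew-symmetry six brackets remain; they are
    polynomial identities in the coordinates. *)

(** * Polynomial functions on a normed space and their smoothness *)

Section polynomial_functions.
Set Implicit Arguments.
Context {R : realType} {M : normedModType R}.
Implicit Types (f g : M -> R) (x v : M).

(** Generating the class inductively lets one induction give its stability under ['D_v]. Linear
    forms must be continuous to be differentiable, as [M] may have infinite dimension. *)
Inductive polynomial_fun : (M -> R) -> Prop :=
| polynomial_cst c : polynomial_fun (cst c)
| polynomial_linear (l : {linear M -> R}) : continuous l -> polynomial_fun l
| polynomialD f g : polynomial_fun f -> polynomial_fun g ->
    polynomial_fun (fun x => f x + g x)
| polynomialM f g : polynomial_fun f -> polynomial_fun g ->
    polynomial_fun (fun x => f x * g x).

Lemma polynomialN f : polynomial_fun f -> polynomial_fun (fun x => - f x).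
Proof.
move=> pf; have -> : (fun x => - f x) = (fun x => cst (-1) x * f x).
  by apply/funext => x; rewrite /= mulN1r.
exact: polynomialM (polynomial_cst _) pf.
Qed.

Lemma polynomial_differentiable f x : polynomial_fun f -> differentiable f x.
Proof.
elim=> [c|l cl|g k _ dg _ dk|g k _ dg _ dk].
- exact: differentiable_cst.
- exact: linear_differentiable.
- exact: differentiableD.
- exact: differentiableM.
Qed.

(** This rule and the next two are in pointwise form, so that [gradient_h] can apply them by
    unification to the expression in [h_crd]. *)
Lemma is_derive_add f g x v (df dg : R) :
  is_derive x v f df -> is_derive x v g dg ->
  is_derive x v (fun y => f y + g y) (df + dg).
Proof. exact: is_deriveD. Qed.

Lemma is_derive_opp f x v (df : R) :
  is_derive x v f df -> is_derive x v (fun y => - f y) (- df).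
Proof. exact: is_deriveN. Qed.

Lemma is_derive_mul f g x v (df dg : R) :
  is_derive x v f df -> is_derive x v g dg ->
  is_derive x v (fun y => f y * g y) (f x * dg + g x * df).
Proof. exact: is_deriveM. Qed.

Lemma is_derive_linear (l : {linear M -> R}) x v : is_derive x v l (l v).
Proof.
apply: (is_derive_quadratic (B := 0)) => t.
by rewrite linearP scaler0 addr0 addrC.
Qed.

Lemma polynomial_derive f v :
  polynomial_fun f -> polynomial_fun (fun x => 'D_v f x).
Proof.
elim=> [c|l cl|g k pg IHg pk IHk|g k pg IHg pk IHk].
- have -> : (fun x => 'D_v (cst c) x) = cst 0.
    by apply/funext => x; rewrite derive_cst.
  exact: polynomial_cst.
- have -> : (fun x => 'D_v l x) = cst (l v).
    by apply/funext => x; apply: derive_val; exact: is_derive_linear.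
  exact: polynomial_cst.
- have -> : (fun x => 'D_v (fun y => g y + k y) x)
      = (fun x => 'D_v g x + 'D_v k x).
    apply/funext => x; apply: deriveD; apply: diff_derivable;
      exact: polynomial_differentiable.
  exact: polynomialD.
- have -> : (fun x => 'D_v (fun y => g y * k y) x)
      = (fun x => g x * 'D_v k x + k x * 'D_v g x).
    apply/funext => x; apply: deriveM; apply: diff_derivable;
      exact: polynomial_differentiable.
  by apply: polynomialD; exact: polynomialM.
Qed.

Lemma polynomial_smooth f : polynomial_fun f -> smooth f.
Proof.
move=> pf vs x; apply: polynomial_differentiable.
by elim: vs => //= v vs; exact: polynomial_derive.
Qed.

End polynomial_functions.

(** * Hamiltonian vectors and Poisson brackets in terms of gradients *)

Section poisson_bracket.
Set Implicit Arguments.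
Context {R : realType}.
Implicit Types (x v : TN R) (f g : TN R -> R).

Definition is_gradient f x (G : TN R) : Prop :=
  forall v, 'D_v f x = dot G.1 v.1 + dot G.2 v.2.

(** Testing the defining equation on vertical vectors determines the base component, because A -
    [p, A] / 2 has inverse A + [p, A] / 2; testing on horizontal vectors then determines the fiber
    component. *)
Lemma hamiltonian_vectorE f x (G : TN R) : is_gradient f x G ->
  hamiltonian_vector f x = (G.2 + 2^-1 *: bracket x.1 G.2,
    coad G.2 x.2 - G.1 - 2^-1 *: coad x.1 G.1).
Proof.
move=> fG; set X := (_, _); have fX : is_hamiltonian_vector f x X.
  move=> v; rewrite fG omegaE /= bracket_shiftr addrK.
  have BE c : bracket c (v.1 - 2^-1 *: bracket x.1 v.1) = bracket c v.1.
    by rewrite -scaleNr bracket_shiftr.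
  rewrite !(dotDr, dotNr, dotZr, dot_coadr) !BE !dot_lin.
  by rewrite (dotC v.1) (dotC (bracket _ _) G.1); field.
(* The existence of [X] ensures that [xget] does not return its default value 0. *)
apply: is_hamiltonian_vector_uniq (fX).
by apply: xgetPex; exists X.
Qed.

(* [G.2 + 2^-1 *: bracket x.1 G.2] is the value at [x.1] of the left-invariant
   field [G.2], and the last term is the Lie-Poisson bracket. *)
Lemma poissonE f g x (F G : TN R) : is_gradient f x F -> is_gradient g x G ->
  poisson f g x = dot F.1 (G.2 + 2^-1 *: bracket x.1 G.2)
    - dot G.1 (F.2 + 2^-1 *: bracket x.1 F.2) - dot x.2 (bracket F.2 G.2).
Proof.
move=> fF gG; rewrite /poisson (hamiltonian_vectorE fF) (hamiltonian_vectorE gG).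
rewrite omegaE /= !bracket_shiftr !addrK !dot_lin (bracketC G.2) !dot_lin.
by rewrite ![dot _ F.1]dotC ![dot _ G.1]dotC; field.
Qed.

Lemma omegaC x u v : omega x u v = - omega x v u.
Proof. by rewrite !omegaE /= (bracketC (v.1 - _)) dotNr; ring. Qed.

Lemma poissonC f g x : poisson f g x = - poisson g f x.
Proof. exact: omegaC. Qed.

Lemma poissonxx f x : poisson f f x = 0.
Proof.
by apply/eqP; rewrite -[_ == 0](mulrn_eq0 _ 2) mulr2n {1}poissonC addNr.
Qed.

End poisson_bracket.

(** * Coordinate expressions and polynomiality of the seven functions *)

Section integrals.
Set Implicit Arguments.
Context {R : realType}.
Implicit Types (x v : TN R) (X Y U : 'rV[R]_7).

Fact base_crd_linear i : linear (fun x : TN R => crd x.1 i : R^o).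
Proof. by move=> t x y; rewrite /= crdD crdS. Qed.

Fact fiber_crd_linear i : linear (fun x : TN R => crd x.2 i : R^o).
Proof. by move=> t x y; rewrite /= crdD crdS. Qed.

(** Indices start at 0: 0 to 3 stand for V_1, ..., V_4 and 4 to 6 for Z_1, Z_2, Z_3. The coordinates
    are named in order to carry a linear structure. *)
Definition base_crd i : TN R -> R := fun x => crd x.1 i.
Definition fiber_crd i : TN R -> R := fun x => crd x.2 i.

HB.instance Definition _ i :=
  GRing.isLinear.Build R (TN R) R^o _ (base_crd i) (base_crd_linear i).
HB.instance Definition _ i :=
  GRing.isLinear.Build R (TN R) R^o _ (fiber_crd i) (fiber_crd_linear i).

Lemma polynomial_base_crd i : polynomial_fun (base_crd i).
Proof.
apply: polynomial_linear => x.
apply: (continuous_comp (f := fst) (g := fun M : 'rV[R]_7 => M 0 (inord i))).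
  exact: cvg_fst.
exact: coord_continuous.
Qed.

Lemma polynomial_fiber_crd i : polynomial_fun (fiber_crd i).
Proof.
apply: polynomial_linear => x.
apply: (continuous_comp (f := snd) (g := fun M : 'rV[R]_7 => M 0 (inord i))).
  exact: cvg_snd.
exact: coord_continuous.
Qed.

Lemma dot0l X : dot 0 X = 0.
Proof. by rewrite -(scale0r 0) dotZl mul0r. Qed.

Lemma dot0r X : dot X 0 = 0.
Proof. by rewrite dotC dot0l. Qed.

Lemma is_derive_fiber_crd i x v :
  is_derive x v (fiber_crd i) (fiber_crd i v).
Proof. exact: is_derive_linear. Qed.

Lemma crd_j_proj_z Y U i : (i < 7)%N -> crd (j (proj_z Y) U) i =
  nth 0 [:: - crd U 1 * crd Y 4; crd U 0 * crd Y 4 - crd U 2 * crd Y 5;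
    crd U 1 * crd Y 5 - crd U 3 * crd Y 6; crd U 2 * crd Y 6; 0; 0; 0] i.
Proof. by move=> i7; rewrite crd_j // !crd_proj_z. Qed.

(** The four squares are those of the coordinates of j(Y_z) Y_v. They are spelled as products to
    match [polynomialM] and [is_derive_mul]. *)
Lemma h_crd x : h x = - (
  fiber_crd 1 x * fiber_crd 4 x * (fiber_crd 1 x * fiber_crd 4 x) +
  (fiber_crd 0 x * fiber_crd 4 x - fiber_crd 2 x * fiber_crd 5 x) *
    (fiber_crd 0 x * fiber_crd 4 x - fiber_crd 2 x * fiber_crd 5 x) +
  (fiber_crd 1 x * fiber_crd 5 x - fiber_crd 3 x * fiber_crd 6 x) *
    (fiber_crd 1 x * fiber_crd 5 x - fiber_crd 3 x * fiber_crd 6 x) +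
  fiber_crd 2 x * fiber_crd 6 x * (fiber_crd 2 x * fiber_crd 6 x)).
Proof.
rewrite /h /fiber_crd dotE !crd_j_proj_z //=.
by rewrite !crd_proj_v //=; ring.
Qed.

Lemma fZ_crd i x : (1 <= i <= 3)%N -> fZ i x = fiber_crd (i + 3) x.
Proof. exact: dotZ. Qed.

Lemma fV1_crd x : fV1 x = fiber_crd 0 x + base_crd 1 x * fiber_crd 4 x.
Proof. by rewrite /fV1 /fiber_crd /base_crd dotE !dotV // !crdE //=; ring. Qed.

Lemma fV4_crd x : fV4 x = fiber_crd 3 x - base_crd 2 x * fiber_crd 6 x.
Proof. by rewrite /fV4 /fiber_crd /base_crd dotE !dotV // !crdE //=; ring. Qed.

Lemma E_crd x : E x = 2^-1 * (fiber_crd 0 x * fiber_crd 0 x +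
  fiber_crd 1 x * fiber_crd 1 x + fiber_crd 2 x * fiber_crd 2 x +
  fiber_crd 3 x * fiber_crd 3 x + fiber_crd 4 x * fiber_crd 4 x +
  fiber_crd 5 x * fiber_crd 5 x + fiber_crd 6 x * fiber_crd 6 x).
Proof. by rewrite /E dotE. Qed.

Ltac polynomial_tac :=
  repeat first [ exact: polynomial_fiber_crd | exact: polynomial_base_crd
    | exact: polynomial_cst | apply: polynomialM | apply: polynomialN
    | apply: polynomialD ].

Lemma polynomial_E : polynomial_fun (E (R := R)).
Proof. rewrite (funext E_crd); polynomial_tac. Qed.

Lemma polynomial_h : polynomial_fun (h (R := R)).
Proof. rewrite (funext h_crd); polynomial_tac. Qed.

Lemma polynomial_fZ i : (1 <= i <= 3)%N -> polynomial_fun (fZ (R := R) i).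
Proof.
move=> i13; rewrite (funext (fun x => fZ_crd i x i13)); exact: polynomial_fiber_crd.
Qed.

Lemma polynomial_fV1 : polynomial_fun (fV1 (R := R)).
Proof. rewrite (funext fV1_crd); polynomial_tac. Qed.

Lemma polynomial_fV4 : polynomial_fun (fV4 (R := R)).
Proof. rewrite (funext fV4_crd); polynomial_tac. Qed.

(** * Gradients of the seven functions *)

Lemma gradient_E x : is_gradient (E (R := R)) x (0, x.2).
Proof.
move=> v; apply: derive_val.
(* [E] is a quadratic form, so its second-order term along [v] is [E v]. *)
apply: (is_derive_quadratic (B := E v)) => t.
rewrite /E !dot_lin (dotC v.2 x.2) /GRing.scale /=.
by rewrite dot0l; field.
Qed.

Lemma gradient_fZ i x : is_gradient (fZ (R := R) i) x (0, Z i).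
Proof.
move=> v; apply: derive_val; apply: (is_derive_quadratic (B := 0)) => t.
by rewrite /fZ !dot_lin dot0l (dotC (Z i)) scaler0 addr0 add0r addrC.
Qed.

Lemma gradient_fV1 x :
  is_gradient fV1 x (crd x.2 4 *: V 2, V 1 + crd x.1 1 *: Z 1).
Proof.
move=> v; apply: derive_val.
apply: (is_derive_quadratic (B := crd v.1 1 * crd v.2 4)) => t.
rewrite !fV1_crd /fiber_crd /base_crd !dotE !crdE //=.
by rewrite /GRing.scale /=; ring.
Qed.

Lemma gradient_fV4 x :
  is_gradient fV4 x (- crd x.2 6 *: V 3, V 4 - crd x.1 2 *: Z 3).
Proof.
move=> v; apply: derive_val.
apply: (is_derive_quadratic (B := - (crd v.1 2 * crd v.2 6))) => t.
rewrite !fV4_crd /fiber_crd /base_crd !dotE !crdE //=.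
by rewrite /GRing.scale /=; ring.
Qed.

(* As j(S) is skew-symmetric, h(p, Y) = - |j(Y_z) Y_v|^2; the two terms are the
   v- and z-components of its gradient in Y. *)
Definition grad_h Y : 'rV[R]_7 :=
  2 *: (j (proj_z Y) (j (proj_z Y) (proj_v Y))
    - bracket (proj_v Y) (j (proj_z Y) (proj_v Y))).

Lemma crd_grad_h Y i : (i < 7)%N -> crd (grad_h Y) i = 2 * nth 0 [::
  - (crd Y 0 * crd Y 4 - crd Y 2 * crd Y 5) * crd Y 4;
  - crd Y 1 * crd Y 4 ^+ 2 - (crd Y 1 * crd Y 5 - crd Y 3 * crd Y 6) * crd Y 5;
  (crd Y 0 * crd Y 4 - crd Y 2 * crd Y 5) * crd Y 5 - crd Y 2 * crd Y 6 ^+ 2;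
  (crd Y 1 * crd Y 5 - crd Y 3 * crd Y 6) * crd Y 6;
  - crd Y 0 * (crd Y 0 * crd Y 4 - crd Y 2 * crd Y 5) - crd Y 1 ^+ 2 * crd Y 4;
  - crd Y 1 * (crd Y 1 * crd Y 5 - crd Y 3 * crd Y 6)
    + crd Y 2 * (crd Y 0 * crd Y 4 - crd Y 2 * crd Y 5);
  - crd Y 2 ^+ 2 * crd Y 6
    + crd Y 3 * (crd Y 1 * crd Y 5 - crd Y 3 * crd Y 6)] i.
Proof.
move=> i7; rewrite crdS; congr (_ * _); move: i i7.
do 7?[case=> [_|]]; last by [].
all: rewrite crdD crdN crd_j_proj_z // crd_bracket // /=.
all: rewrite ?crd_j_proj_z // /= ?crd_proj_v //=; ring.
Qed.

(** Since [h] is quartic, [is_derive_quadratic] gives way to the sum and product rules;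
    [is_derive_eq] leaves the derivative open until they have computed it. *)
Lemma gradient_h x : is_gradient h x (0, grad_h x.2).
Proof.
move=> v; apply: derive_val; rewrite (funext h_crd).
apply: is_derive_eq.
  by repeat first [ exact: is_derive_fiber_crd | apply: is_derive_mul
    | apply: is_derive_opp | apply: is_derive_add ].
by rewrite /fiber_crd dot0l add0r dotE !crd_grad_h //=; ring.
Qed.

(** * Vanishing of the Poisson brackets *)

Lemma poisson_fZ i f x (F : TN R) : (1 <= i <= 3)%N ->
  is_gradient f x F -> dot F.1 (Z i) = 0 -> poisson f (fZ i) x = 0.
Proof.
move=> i13 fF FZ; rewrite (poissonE fF (gradient_fZ i x)) /= dot0l.
by rewrite !(bracketC _ (Z i)) !bracket_Z // oppr0 scaler0 addr0 FZ dot0r !subr0.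
Qed.

Ltac poisson_crd := rewrite /= ?dot0l !dotE; rewrite ?crdE // !crd_bracket //=;
  rewrite ?crdE //=; ring.

(* [grad_h x.2] is generalized because rewriting with [crdE] would otherwise
   unfold it repeatedly. *)
Lemma poisson_E_h x : poisson E h x = 0.
Proof.
rewrite (poissonE (gradient_E x) (gradient_h x)) /=.
move: (grad_h x.2) (crd_grad_h x.2) => b bE; rewrite ?dot0l !dotE.
rewrite ?crdE // !crd_bracket //= ?crdE //= !bE //=; ring.
Qed.

(** Conceptually, V_1 + <W, V_2> Z_1 = V_1 - [W, V_1] is the right-invariant field of V_1 in the
    left trivialization. Thus [fV1] is a momentum of left translations, which preserve functions of
    Y alone such as [E] and [h]. The same holds for [fV4]. *)
Lemma poisson_E_fV1 x : poisson E fV1 x = 0.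
Proof. rewrite (poissonE (gradient_E x) (gradient_fV1 x)); poisson_crd. Qed.

Lemma poisson_E_fV4 x : poisson E fV4 x = 0.
Proof. rewrite (poissonE (gradient_E x) (gradient_fV4 x)); poisson_crd. Qed.

Lemma poisson_h_fV1 x : poisson h fV1 x = 0.
Proof.
rewrite (poissonE (gradient_h x) (gradient_fV1 x)) /=.
move: (grad_h x.2) (crd_grad_h x.2) => b bE; rewrite ?dot0l !dotE.
rewrite ?crdE // !crd_bracket //= ?crdE //= !bE //=; ring.
Qed.

Lemma poisson_h_fV4 x : poisson h fV4 x = 0.
Proof.
rewrite (poissonE (gradient_h x) (gradient_fV4 x)) /=.
move: (grad_h x.2) (crd_grad_h x.2) => b bE; rewrite ?dot0l !dotE.
rewrite ?crdE // !crd_bracket //= ?crdE //= !bE //=; ring.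
Qed.

(** This reflects [V_1, V_4] = 0 at the level of momenta. *)
Lemma poisson_fV1_fV4 x : poisson fV1 fV4 x = 0.
Proof. rewrite (poissonE (gradient_fV1 x) (gradient_fV4 x)); poisson_crd. Qed.

Let noncentral_integrals : set (TN R -> R) := [set E; h; fV1; fV4].

Lemma poisson_noncentral_integrals f g x :
  noncentral_integrals f -> noncentral_integrals g -> poisson f g x = 0.
Proof.
have P := (poisson_E_h, poisson_E_fV1, poisson_E_fV4, poisson_h_fV1,
  poisson_h_fV4, poisson_fV1_fV4).
by move=> [[[->|->]|->]|->] [[[->|->]|->]|->];
  rewrite ?(poissonxx, P) // poissonC P oppr0.
Qed.

Lemma poisson_noncentral_fZ i f x : (1 <= i <= 3)%N ->
  noncentral_integrals f -> poisson f (fZ i) x = 0.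
Proof.
move=> i13 [[[->|->]|->]|->].
- by apply: (poisson_fZ i13 (gradient_E x)); rewrite dot0l.
- by apply: (poisson_fZ i13 (gradient_h x)); rewrite dot0l.
(* Here and in the next case the base gradient is a multiple of V_2, respectively V_3, hence
   orthogonal to the center. *)
- apply: (poisson_fZ i13 (gradient_fV1 x)); rewrite /= dotZ // crdE.
  by case: i i13 => [|[|[|[|]]]] // _; rewrite crdV //= mulr0.
- apply: (poisson_fZ i13 (gradient_fV4 x)); rewrite /= dotZ // crdE.
  by case: i i13 => [|[|[|[|]]]] // _; rewrite crdV //= mulr0.
Qed.

Lemma poisson_fZ_fZ i k x : (1 <= k <= 3)%N -> poisson (fZ i) (fZ k) x = 0.
Proof. by move=> k13; apply: (poisson_fZ k13 (gradient_fZ i x)); rewrite dot0l. Qed.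

End integrals.

Theorem mainTheorem6 (R : realType) :
  let F : set (TN R -> R) := [set E; h; fZ 1; fZ 2; fZ 3; fV1; fV4] in
  (forall f, F f -> first_integral f) /\ in_involution F.
Proof.
move=> F.
have FP f : F f -> [set E; h; fV1; fV4] f \/ exists2 i, (1 <= i <= 3)%N & f = fZ i.
  move=> [[[[[[->|->]|->]|->]|->]|->]|->].
  - by left; do 3 left.
  - by left; left; left; right.
  - by right; exists 1%N.
  - by right; exists 2%N.
  - by right; exists 3%N.
  - by left; left; right.
  - by left; right.
have FF : in_involution F.
  move=> f g /FP[Qf|[i i13 ->]] /FP[Qg|[k k13 ->]] x.
  - exact: poisson_noncentral_integrals.
  - exact: poisson_noncentral_fZ.
  - by rewrite poissonC poisson_noncentral_fZ ?oppr0.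
  - exact: poisson_fZ_fZ.
(* The bracket with [E] vanishes by involution, [E] being the innermost member of the left-nested
   union [F]. *)
split=> // f Ff; split; last by move=> x; apply: FF => //; do 6 left.
apply: polynomial_smooth; case: Ff => [[[[[[->|->]|->]|->]|->]|->]|->].
- exact: polynomial_E.
- exact: polynomial_h.
- exact: polynomial_fZ.
- exact: polynomial_fZ.
- exact: polynomial_fZ.
- exact: polynomial_fV1.
- exact: polynomial_fV4.
Qed.
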